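(* Let $p,q$ be integers with $3\le p<q$, and write $q=kp+r$ with integers $k$ and $0\le r<p$. The minimal $H$-representation of the generalized alternating sign matrix polytope $\mathcal{ASM}_{p,q}$ consists of the $2((p-1)(q-2)+2)+2(p-2)(q-k-1)$ inequalities \begin{enumerate} \item[(a1)] $x_{11}\ge 0$, $x_{1q}\ge 0$, $x_{p1}\ge 0$, $x_{pq}\ge 0$; \item[(a2)] $\sum_{\ell=1}^{i}x_{\ell j}\ge 0$ and $\sum_{\ell=i+1}^{p}x_{\ell j}\ge 0$ for all $i\in\{1,\dots,p-1\}$, $j\in\{2,\dots,q-1\}$; \item[(a3)] $\sum_{h=1}^{j}x_{ih}\ge 0$ and $\sum_{h=q-j+1}^{q}x_{ih}\ge 0$ for all $i\in\{2,\dots,p-1\}$, $j\in\{1,\dots,q-k-1\}$. \end{enumerate} That is, a matrix $[x_{ij}]\in\mathbb{R}^{p\times q}$ all of whose row sums equal $q$ and all of whose column sums equal $p$ lies in $\mathcal{ASM}_{p,q}$ if and only if it satisfies (a1), (a2), (a3); and none of these inequalities can be omitted, i.e. for each of them there is a real $p\times q$ matrix with all row sums $q$ and all column sums $p$ that satisfies all the other listed inequalities but violates that one.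
   Context: The generalized alternating sign matrix polytope $\mathcal{ASM}_{p,q}$ is the set of all $[x_{ij}]\in\mathbb{R}^{p\times q}$ satisfying (1) $\sum_{\ell=1}^p x_{\ell j}=p$ and $\sum_{h=1}^q x_{ih}=q$ for all $1\le i\le p$, $1\le j\le q$; (2) $0\le\sum_{\ell=1}^i x_{\ell j}\le p$ for all $1\le i\le p$, $1\le j\le q$; (3) $0\le\sum_{h=1}^j x_{ih}\le q$ for all $1\le i\le p$, $1\le j\le q$. The polytope is regarded inside the affine space cut out by the equalities (1) (in which it has full dimension $(p-1)(q-1)$); its minimal $H$-representation is its irredundant system of defining affine inequalities there, unique up to positive scaling. *)

(* Defs.v *)
From HB Require Import structures.
From mathcomp Require Import all_boot all_order all_algebra.
From mathcomp Require Import classical_sets reals.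

Set Implicit Arguments.
Unset Strict Implicit.
Unset Printing Implicit Defensive.

Import Order.TTheory GRing.Theory Num.Theory.
Local Open Scope classical_set_scope.
Local Open Scope ring_scope.

Section GeneralizedASM.
Variables (R : realType) (p q : nat).

Definition line_sum_space : set 'M[R]_(p, q) :=
  [set x | (forall j, \sum_l x l j = p%:R) /\ (forall i, \sum_h x i h = q%:R)].

(* Ordinals start at 0, so [l <= i] ranges over the first i+1 rows. *)
Definition ASM : set 'M[R]_(p, q) :=
  [set x | [/\ line_sum_space x,
    (forall i j, 0 <= \sum_(l < p | (l <= i)%N) x l j <= p%:R) &
    (forall i j, 0 <= \sum_(h < q | (h <= j)%N) x i h <= q%:R)]].

(* [(a, b)] stands for the affine inequality [\sum_(i, j) a_ij x_ij >= b]. *)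
Notation affine_ineq := ('M[R]_(p, q) * R)%type.

Definition satisfies (c : affine_ineq) (x : 'M[R]_(p, q)) : bool :=
  c.2 <= \sum_i \sum_j c.1 i j * x i j.

(* Minimality inside the affine space [L]: [s] cuts [P] out of [L], and every
   inequality of [s] is violated by a point of [L] satisfying all the others. *)
Definition minimal_H_representation (L P : set 'M[R]_(p, q))
    (s : seq affine_ineq) : Prop :=
  [/\ uniq s,
      P `<=` L,
      (forall x, L x -> (P x <-> forall c, c \in s -> satisfies c x)) &
      (forall c, c \in s -> exists x, [/\ L x,
         (forall d, d \in s -> d != c -> satisfies d x) &
         ~~ satisfies c x])].

(* [0 <= \sum x_lh] over the cells (l, h) in [S], rows and columns being
   numbered from 1 in [S] and in everything below. *)
Definition cells_ge0 (S : nat -> nat -> bool) : affine_ineq :=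
  (\matrix_(l < p, h < q) (S l.+1 h.+1)%:R, 0).

Definition entry_ge0 (i j : nat) :=
  cells_ge0 (fun l h => (l == i) && (h == j)).
Definition col_top_ge0 (i j : nat) :=
  cells_ge0 (fun l h => (l <= i)%N && (h == j)).
Definition col_bottom_ge0 (i j : nat) :=
  cells_ge0 (fun l h => (i + 1 <= l)%N && (h == j)).
Definition row_left_ge0 (i j : nat) :=
  cells_ge0 (fun l h => (l == i) && (h <= j)%N).
Definition row_right_ge0 (i j : nat) :=
  cells_ge0 (fun l h => (l == i) && (q - j + 1 <= h)%N).

(* [index_iota m n] enumerates m, ..., n - 1. *)
Definition corner_ineqs : seq affine_ineq :=
  [:: entry_ge0 1 1; entry_ge0 1 q; entry_ge0 p 1; entry_ge0 p q].

Definition column_ineqs : seq affine_ineq :=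
  [seq col_top_ge0 i j | i <- index_iota 1 p, j <- index_iota 2 q] ++
  [seq col_bottom_ge0 i j | i <- index_iota 1 p, j <- index_iota 2 q].

Definition row_ineqs (k : nat) : seq affine_ineq :=
  [seq row_left_ge0 i j | i <- index_iota 2 p, j <- index_iota 1 (q - k)] ++
  [seq row_right_ge0 i j | i <- index_iota 2 p, j <- index_iota 1 (q - k)].

Definition ASM_ineqs (k : nat) : seq affine_ineq :=
  corner_ineqs ++ column_ineqs ++ row_ineqs k.

End GeneralizedASM.

(* Main.v *)
(** The listed inequalities make every column sum over an initial or final
    segment nonnegative, so each entry is at most [p]. A segment of a row which
    is not listed has a complement of at most [k] cells, whose sum is at most
    [k p <= q]; hence its own sum is nonnegative as well.

    For irredundancy, put in one column [j] a vector [v] with sum [p] exactly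
    one of whose partial sums from either end is negative, such as
    [(0, ..., 0, -1, c, ..., c)], and fill each row [l] with the constant
    [(q - v_l) / (q - 1)]. The only negative entry is [-1], and any second entry
    of its row compensates it. The rows are treated by transposition; there the
    bound [c <= p] amounts to [q + 1 <= p (k + 1)]. *)

Require Import Defs.
From HB Require Import structures.
From mathcomp Require Import all_boot all_order all_algebra.
From mathcomp Require Import classical_sets reals.
From mathcomp Require Import zify ring lra.

Set Implicit Arguments.
Unset Strict Implicit.
Unset Printing Implicit Defensive.

Import Order.TTheory GRing.Theory Num.Theory.
Local Open Scope ring_scope.

(** * Sums over initial and final segments *)

(** Both kinds of segment are given by their cut position [m], so that negating [b] yields the
    complementary segment. *)
Definition side (b : bool) (m l : nat) : bool :=
  if b then (l < m)%N else (m <= l)%N.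

Lemma sum_side_compl (V : zmodType) (n : nat) (F : 'I_n -> V) b m :
  \sum_(l < n | side b m l) F l =
  \sum_l F l - \sum_(l < n | side (~~ b) m l) F l.
Proof.
rewrite [\sum_l F l](bigID (fun l : 'I_n => side b m l)) /=.
rewrite [X in _ + X - _](eq_bigl (fun l : 'I_n => side (~~ b) m l)) ?addrK //.
by move=> l; rewrite /side; case: b => /=; rewrite -?leqNgt -?ltnNge.
Qed.

Lemma sum_side_rev (V : zmodType) (n : nat) (F : nat -> V) b m :
  (m <= n)%N ->
  \sum_(l < n | side b m l) F (n - l.+1)%N =
  \sum_(l < n | side (~~ b) (n - m) l) F l.
Proof.
move=> le_mn; rewrite (reindex_inj rev_ord_inj); apply: eq_big => [l|l _] /=.
  by rewrite /side; have := ltn_ord l; case: b => /=; lia.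
by congr F; have := ltn_ord l; lia.
Qed.

Lemma sum_side_telescope (V : zmodType) (n : nat) (P : nat -> V) m :
  (m <= n)%N -> \sum_(l < n | side true m l) (P l.+1 - P l) = P m - P 0%N.
Proof.
move=> le_mn; rewrite -(telescope_sumr P (leq0n m)) big_mkord.
by rewrite (big_ord_widen_cond _ xpredT (fun l => P l.+1 - P l) le_mn).
Qed.

(** * Vectors with exactly one negative segment sum *)

(** The upper bound is the average over the complementary segment when the chosen segment sums to
    [-1]. The last clause places a negative entry next to the cut, inside the chosen segment. *)
Definition dent_vector {R : realFieldType} (n : nat) (b : bool) (m : nat)
    (v : nat -> R) : Prop :=
  [/\ \sum_(l < n) v l = n%:R,
      forall b' m', (m' <= n)%N ->
        (0 <= \sum_(l < n | side b' m' l) v l) = ((b', m') != (b, m)),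
      forall l, (l < n)%N ->
        -1 <= v l <= n.+1%:R / (if b then n - m else m)%N%:R &
      forall l, (l < n)%N -> v l < 0 -> l = if b then m.-1 else m].

Lemma dent_vector_prefix (R : realFieldType) (n m : nat) :
  (0 < m < n)%N -> exists v : nat -> R, dent_vector n true m v.
Proof.
move=> /andP[m_gt0 lt_mn].
(* After the partial sum [-1] at [m], the remaining [n - m] entries must raise it to [n]. *)
set s : R := n.+1%:R / (n - m)%:R.
have nm_gt0 : 0 < (n - m)%:R :> R by rewrite ltr0n subn_gt0.
have s_n : s * (n - m)%:R = n%:R + 1 by rewrite divfK ?gt_eqF // -natr1.
have s_ge1 : 1 <= s by rewrite ler_pdivlMr // mul1r ler_nat; lia.
(* The partial sums are prescribed and the vector is their difference: a prefix sum is [P a], a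
   suffix sum is [n - P a], so it suffices that [P <= n] and that [P] is negative only at [m]. *)
pose P (a : nat) : R := if (a < m)%N then 0 else s * (a - m)%:R - 1.
have P0 : P 0%N = 0 by rewrite /P m_gt0.
have Pn : P n = n%:R by rewrite /P ltnNge ltnW //= s_n addrK.
have P_le a : (a <= n)%N -> P a <= n%:R.
  rewrite /P; case: ltnP => // le_ma le_an.
  rewrite lerBlDr -s_n ler_pM2l ?ler_nat; first lia.
  exact: lt_le_trans s_ge1.
have P_ge a : (0 <= P a) = (a != m).
  rewrite /P; case: ltngtP => [|lt_ma|->]; rewrite ?lexx //.
    rewrite subr_ge0; apply: (le_trans s_ge1).
    by apply: ler_peMr; [exact: le_trans s_ge1|rewrite ler1n subn_gt0].
  by rewrite subnn mulr0 sub0r oppr_ge0 ler10.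
have pre a : (a <= n)%N -> \sum_(l < n | side true a l) (P l.+1 - P l) = P a.
  by move=> le_an; rewrite sum_side_telescope // P0 subr0.
have step l : P l.+1 - P l =
    if (l.+1 < m)%N then 0 else if l.+1 == m then -1 else s.
  rewrite /P; case: (ltngtP l.+1 m) => [lt_lm|lt_ml|<-].
  - by rewrite subrr.
  - rewrite subSn // -natr1; ring.
  - by rewrite subnn mulr0 sub0r subr0.
exists (fun l => P l.+1 - P l); split.
- rewrite -[RHS]Pn -pre //; apply: eq_bigl => l; exact/esym/ltn_ord.
- move=> [] a le_an; rewrite xpair_eqE ?eqxx /=; first by rewrite pre.
  rewrite (sum_side_compl (fun l : 'I_n => P l.+1 - P l) false) /=.
  rewrite pre // subr_ge0.
  rewrite (_ : \sum_(l < n) _ = P n); first by rewrite Pn P_le.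
  by rewrite -pre //; apply: eq_bigl => l; exact/esym/ltn_ord.
- move=> l _; rewrite step -/s; case: ifP => _; last case: ifP => _;
    apply/andP; split; lra.
- move=> l _; rewrite step; case: ifP => _; rewrite ?ltxx //.
  by case: eqP => [<- //|_ s_lt0]; exfalso; lra.
Qed.

Lemma dent_vector_exists (R : realFieldType) (n m : nat) (b : bool) :
  (0 < m < n)%N -> exists v : nat -> R, dent_vector n b m v.
Proof.
case: b => lt_mn; first exact: dent_vector_prefix.
(* A suffix becomes a prefix when the vector is reversed, the cut moving to [n - m]. *)
have /(dent_vector_prefix R)[v [v_sum v_side v_le v_neg]] : (0 < n - m < n)%N by lia.
have nmK : (n - (n - m) = m)%N by lia.
exists (fun l => v (n - l.+1)%N); split.
- rewrite -v_sum (reindex_inj rev_ord_inj); apply: eq_bigr => l _ /=.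
  by congr v; have := ltn_ord l; lia.
- move=> b' m' le_mn; rewrite sum_side_rev // v_side ?leq_subr // !xpair_eqE.
  by case: b' => //=; lia.
- by move=> l lt_ln; rewrite -[m in X in _ <= _ <= X]nmK v_le //; lia.
- by move=> l lt_ln /v_neg; lia.
Qed.

(** * Matrices with one prescribed column and otherwise constant rows *)

Definition cross_mx {R : realFieldType} (p q : nat) (j : 'I_q) (v : nat -> R) :
    'M[R]_(p, q) :=
  \matrix_(l, h) if h == j then v l else (q%:R - v l) / (q%:R - 1).

Section Cross.
Variables (R : realFieldType) (p q : nat) (j : 'I_q) (v : nat -> R).
Hypotheses (q_gt1 : (1 < q)%N).

Let q1_gt0 : 0 < q%:R - 1 :> R.
Proof. by rewrite subr_gt0 ltr1n. Qed.

Lemma cross_mx_row_sum i : \sum_h cross_mx p j v i h = q%:R.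
Proof.
rewrite (bigD1 j) //= mxE eqxx.
rewrite (eq_bigr (fun=> (q%:R - v i) / (q%:R - 1))); last first.
  by move=> h /negbTE neq; rewrite mxE neq.
rewrite sumr_const cardC1 card_ord -[X in _ + X]mulr_natr.
by rewrite -subn1 natrB ?(ltnW q_gt1) // divfK ?gt_eqF // addrC subrK.
Qed.

(** Off column [j] the sum is [(p q - p) / (q - 1) = p], since [v] sums to [p]. *)
Lemma cross_mx_col_sum h : \sum_(l < p) v l = p%:R ->
  \sum_l cross_mx p j v l h = p%:R.
Proof.
move=> v_sum; have [->|neq] := eqVneq h j.
  by rewrite -v_sum; apply: eq_bigr => l _; rewrite mxE eqxx.
rewrite (eq_bigr (fun l : 'I_p => (q%:R - v l) / (q%:R - 1))); last first.
  by move=> l _; rewrite mxE (negbTE neq).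
rewrite -mulr_suml sumrB v_sum sumr_const card_ord -[q%:R *+ p]mulr_natr.
by rewrite -[X in _ - X]mul1r -mulrBl mulrC mulKf // gt_eqF.
Qed.

Hypothesis v_bound : forall l, (l < p)%N -> -1 <= v l <= q%:R.

Lemma cross_mx_ge0 l h : h != j -> 0 <= cross_mx p j v l h.
Proof.
move=> /negbTE neq; rewrite mxE neq divr_ge0 ?(ltW q1_gt0) //.
by have /andP[_] := v_bound (ltn_ord l); rewrite subr_ge0.
Qed.

(* One further entry of the row outweighs an entry which is at least -1. *)
Lemma cross_mx_row_ge0 (l : 'I_p) (S : pred 'I_q) :
  (S j -> (0 <= v l) \/ exists2 h, S h & h != j) ->
  0 <= \sum_(h | S h) cross_mx p j v l h.
Proof.
have [Sj /(_ isT) other|Sj _] := boolP (S j); last first.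
  by apply: sumr_ge0 => h Sh; apply: cross_mx_ge0; apply: contraNneq Sj => <-.
rewrite (bigD1 j) //=; case: other => [v_ge0|[h Sh neq]].
  rewrite addr_ge0 //; first by rewrite mxE eqxx.
  by apply: sumr_ge0 => h /andP[_]; apply: cross_mx_ge0.
rewrite (bigD1 h) /= ?Sh // addrA addr_ge0 //; last first.
  by apply: sumr_ge0 => h' /andP[/andP[_ ?] _]; apply: cross_mx_ge0.
rewrite !mxE eqxx (negbTE neq).
have /andP[v_ge _] := v_bound (ltn_ord l).
have q_ge2 : 2 <= q%:R :> R by rewrite (ler_nat R 2 q).
(* This form of [v + (q - v) / (q - 1)] shows the sign for [v >= -1] and [q >= 2]. *)
rewrite (_ : _ + _ = ((v l + 1) * (q%:R - 2) + 2) / (q%:R - 1)); last first.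
  by field; rewrite gt_eqF.
rewrite divr_ge0 ?(ltW q1_gt0) // addr_ge0 // mulr_ge0 // ?subr_ge0 //.
by rewrite -lerBlDr sub0r.
Qed.

End Cross.

(** * Bounds on segment sums *)

Lemma sum_side_le (R : realFieldType) (n m : nat) b (F : 'I_n -> R) (c : R) :
  (m <= n)%N -> (forall l, F l <= c) ->
  \sum_(l < n | side b m l) F l <= (if b then m else n - m)%N%:R * c.
Proof.
move=> le_mn F_le; apply: (@le_trans _ _ (\sum_(l < n | side b m l) c)).
  exact: ler_sum.
(* The indices below [m] are counted by telescoping [l * c]. *)
have pre : \sum_(l < n | side true m l) c = m%:R * c.
  have := sum_side_telescope (fun l => l%:R * c) le_mn; rewrite mul0r subr0 => <-.
  by apply: eq_bigr => l _; rewrite -natr1 mulrDl mul1r addrAC subrr add0r.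
case: b; first by rewrite pre.
rewrite (sum_side_compl (fun=> c) false) pre sumr_const card_ord.
by rewrite -[c *+ n]mulr_natl -mulrBl -natrB.
Qed.

Lemma sum_side_succ (V : zmodType) (n : nat) (F : 'I_n -> V) (i : 'I_n) :
  \sum_(l < n | side true i.+1 l) F l = \sum_(l < n | side true i l) F l + F i.
Proof.
rewrite (bigD1 i) /side /= ?ltnS // addrC; congr (_ + _).
by apply: eq_bigl => l; rewrite ltnS (ltn_neqAle l) andbC.
Qed.

Lemma sum_side_all (V : zmodType) (n : nat) (F : 'I_n -> V) b m :
  (m == 0)%N || (n <= m)%N ->
  \sum_(l < n | side b m l) F l = if b == (m != 0)%N then \sum_l F l else 0.
Proof.
move=> m_out; case: eqP => b_m.
  by apply: eq_bigl => l; rewrite /side; have := ltn_ord l; case: b b_m; lia.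
by apply: big_pred0 => l; rewrite /side; have := ltn_ord l; case: b b_m; lia.
Qed.

(** An upper bound [c] on a prefix sum is nonnegativity of the complementary suffix sum, the total
    being [c]. *)
Lemma prefix_bounds_sides (R : realFieldType) (n : nat) (F : 'I_n -> R) (c : R) :
  \sum_l F l = c -> 0 <= c ->
  (forall i : nat, 0 <= \sum_(l < n | (l <= i)%N) F l <= c) <->
  (forall b m, 0 <= \sum_(l < n | side b m l) F l).
Proof.
move=> F_sum c_ge0.
have sideS i : \sum_(l < n | (l <= i)%N) F l = \sum_(l < n | side true i.+1 l) F l.
  by apply: eq_bigl => l.
split=> [bounds b m|sides i]; last first.
  by rewrite sideS sides -F_sum -subr_ge0 -(sum_side_compl F false) sides.
(* Cut [0] matches no prefix [l <= i]; its segments are empty or the whole line. *)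
case: m => [|m]; first by rewrite sum_side_all // F_sum; case: ifP.
have := bounds m; rewrite sideS => /andP[ge0 le_c].
by case: b => //; rewrite sum_side_compl F_sum subr_ge0.
Qed.

(** * Indexing the inequalities *)

Section Facets.
Variables (R : realType) (p q k : nat).

(* [(true, b, j, m)] is the inequality on the first [m] ([b = true]) or last
   [p - m] ([b = false]) entries of column [j], and [(false, b, i, m)] the one
   on the first or last [m] entries of row [i]. *)
Definition line_ineq (t : bool * bool * nat * nat) : 'M[R]_(p, q) * R :=
  let: (c, b, i, m) := t in
  if c then if b then col_top_ge0 R p q m i else col_bottom_ge0 R p q m i
  else if b then row_left_ge0 R p q i m else row_right_ge0 R p q i m.

(** The order is that of [ASM_ineqs]; the corner entries are encoded as one-cell segments of the
    outer columns. *)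
Definition facets : seq (bool * bool * nat * nat) :=
  [:: (true, true, 1, 1); (true, true, q, 1);
      (true, false, 1, p.-1); (true, false, q, p.-1)]%N ++
  ([seq (true, true, j, i) | i <- index_iota 1 p, j <- index_iota 2 q] ++
   [seq (true, false, j, i) | i <- index_iota 1 p, j <- index_iota 2 q]) ++
  ([seq (false, true, i, j) | i <- index_iota 2 p, j <- index_iota 1 (q - k)] ++
   [seq (false, false, i, j) | i <- index_iota 2 p, j <- index_iota 1 (q - k)]).

(** Membership in [facets] as an arithmetic condition: in the outer columns only the one-cell
    segments with cut [1] or [p - 1] remain. *)
Definition facet (t : bool * bool * nat * nat) : bool :=
  let: (c, b, i, m) := t in
  if c then [&& (0 < m < p)%N, (0 < i <= q)%N &
                (1 < i < q)%N || (m == if b then 1 else p.-1)%N]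
  else (1 < i < p)%N && (0 < m < q - k)%N.

Lemma mem_row_indices (c b c' b' : bool) (i m : nat) (s t : seq nat) :
  ((c, b, i, m) \in [seq (c', b', x, y) | x <- s, y <- t]) =
  [&& c == c', b == b', i \in s & m \in t].
Proof.
apply/allpairsP/and4P => [[[x y] /= [xs yt [-> -> -> ->]]]|[/eqP-> /eqP-> im mt]] //.
by exists (i, m).
Qed.

Lemma mem_col_indices (c b c' b' : bool) (i m : nat) (s t : seq nat) :
  ((c, b, i, m) \in [seq (c', b', y, x) | x <- s, y <- t]) =
  [&& c == c', b == b', m \in s & i \in t].
Proof.
apply/allpairsP/and4P => [[[x y] /= [xs yt [-> -> -> ->]]]|[/eqP-> /eqP-> im mt]] //.
by exists (m, i).
Qed.

Definition mem_indices := (mem_cat, mem_row_indices, mem_col_indices, mem_index_iota).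

Lemma mem_facets t : (3 <= p)%N -> (p < q)%N -> (t \in facets) = facet t.
Proof.
move=> hp hpq; case: t => -[[c b] i] m; rewrite !mem_indices !inE !xpair_eqE /facet.
by case: c; case: b => //=; lia.
Qed.

Lemma facets_uniq : (3 <= p)%N -> (p < q)%N -> uniq facets.
Proof.
move=> hp hpq.
have ipair (c b : bool) (s t : seq nat) : uniq s -> uniq t ->
    uniq [seq (c, b, i, j) | i <- s, j <- t].
  by move=> us ut; apply: allpairs_uniq => // -[a1 a2] [b1 b2] _ _ [-> ->].
have jpair (c b : bool) (s t : seq nat) : uniq s -> uniq t ->
    uniq [seq (c, b, j, i) | i <- s, j <- t].
  by move=> us ut; apply: allpairs_uniq => // -[a1 a2] [b1 b2] _ _ [-> ->].
rewrite !cat_uniq !ipair ?jpair ?iota_uniq //= !andbT.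
apply/and4P; split.
- by rewrite !inE !xpair_eqE /=; lia.
- apply/hasPn => -[[[c b] i] m]; rewrite !mem_indices !inE !xpair_eqE.
  by case: c; case: b => //=; lia.
- apply/hasPn => -[[[c b] i] m]; rewrite !mem_indices.
  by case: c; case: b => //=; lia.
apply/andP; split; apply/hasPn => -[[[c b] i] m]; rewrite !mem_indices;
  by case: c; case: b => //=; lia.
Qed.

Lemma ASM_ineqs_facets : (0 < p)%N -> ASM_ineqs R p q k = map line_ineq facets.
Proof.
move=> p_gt0.
rewrite /facets !map_cat !map_allpairs /ASM_ineqs; congr (_ ++ _).
have top j : entry_ge0 R p q 1 j = col_top_ge0 R p q 1 j.
  rewrite /entry_ge0 /col_top_ge0 /cells_ge0; congr (_, _).
  by apply/matrixP => l h; rewrite !mxE; congr ((_ && _)%:R); lia.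
have bottom j : entry_ge0 R p q p j = col_bottom_ge0 R p q p.-1 j.
  rewrite /entry_ge0 /col_bottom_ge0 /cells_ge0; congr (_, _).
  apply/matrixP => l h; rewrite !mxE; congr ((_ && _)%:R).
  by have := ltn_ord l; lia.
by rewrite /corner_ineqs !top !bottom.
Qed.

(** * Inequalities as segment sums *)

Lemma satisfies_cells (S : nat -> nat -> bool) (x : 'M[R]_(p, q)) :
  satisfies (cells_ge0 R p q S) x =
  (0 <= \sum_(l < p) \sum_(h < q | S l.+1 h.+1) x l h).
Proof.
rewrite /satisfies /=; congr (0 <= _); apply: eq_bigr => l _.
rewrite [RHS]big_mkcond; apply: eq_bigr => h _; rewrite mxE.
by case: (S _ _); rewrite ?mul1r ?mul0r.
Qed.

Lemma satisfies_col b m (j : 'I_q) (x : 'M[R]_(p, q)) :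
  satisfies (line_ineq (true, b, j.+1, m)) x =
  (0 <= \sum_(l < p | side b m l) x l j).
Proof.
suff gen (A : nat -> bool) :
    satisfies (cells_ge0 R p q (fun l h => A l && (h == j.+1))) x =
    (0 <= \sum_(l < p | A l.+1) x l j).
  case: b; rewrite /= gen; congr (0 <= _); apply: eq_bigl => l //.
  by rewrite /side; lia.
rewrite satisfies_cells; congr (0 <= _); rewrite [RHS]big_mkcond.
apply: eq_bigr => l _; case: (A _) => /=; last by rewrite big_pred0.
by rewrite (big_pred1 j).
Qed.

Lemma satisfies_row b m (i : 'I_p) (x : 'M[R]_(p, q)) : (m <= q)%N ->
  satisfies (line_ineq (false, b, i.+1, m)) x =
  (0 <= \sum_(h < q | side b (if b then m else q - m)%N h) x i h).
Proof.
move=> le_mq.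
suff gen (A : nat -> bool) :
    satisfies (cells_ge0 R p q (fun l h => (l == i.+1) && A h)) x =
    (0 <= \sum_(h < q | A h.+1) x i h).
  case: b; rewrite /= gen; congr (0 <= _); apply: eq_bigl => l //.
  by rewrite /side; lia.
rewrite satisfies_cells; congr (0 <= _); rewrite (bigD1 i) //= eqxx.
rewrite [X in _ + X]big1 ?addr0 // => l neq.
by rewrite big_pred0 // => h; rewrite eqSS val_eqE (negbTE neq).
Qed.

(** * The listed inequalities describe the polytope *)

Hypotheses (hp : (3 <= p)%N) (hpq : (p < q)%N).
Hypotheses (k_lb : (k * p <= q)%N) (k_ub : (q < k.+1 * p)%N).

(** This makes the one-cell row segments part of the list. *)
Lemma cut_lt : (k.+1 < q)%N.
Proof. nia. Qed.

(** The sign of the boundary entries comes first, from one-cell segments; it settles the outer rows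
    and columns. The inner columns are listed, and they bound the entries, which in turn settles the
    long row segments. *)
Lemma facets_sides (x : 'M[R]_(p, q)) : line_sum_space x ->
  (forall t, facet t -> satisfies (line_ineq t) x) ->
  (forall j b m, 0 <= \sum_(l < p | side b m l) x l j) /\
  (forall i b m, 0 <= \sum_(h < q | side b m h) x i h).
Proof.
move=> [col_sum row_sum] sat; have k_lt := cut_lt.
have top_ge0 (i : 'I_p) j : i = 0%N :> nat -> 0 <= x i j.
  move=> i0; have := sat (true, true, j.+1, 1%N); rewrite satisfies_col.
  rewrite (big_pred1 i) /=; first by apply; have := ltn_ord j; lia.
  by move=> l; rewrite /side /= -val_eqE /=; lia.
have bottom_ge0 (i : 'I_p) j : i = p.-1 :> nat -> 0 <= x i j.
  move=> ip; have := sat (true, false, j.+1, p.-1); rewrite satisfies_col.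
  rewrite (big_pred1 i) /=; first by apply; have := ltn_ord j; lia.
  by move=> l; rewrite /side /= -val_eqE /=; have := ltn_ord l; lia.
have left_ge0 i (j : 'I_q) : j = 0%N :> nat -> 0 <= x i j.
  move=> j0; have [i0|i_gt0] := posnP i; first exact: top_ge0.
  have [ip|i_lt] := eqVneq (i : nat) p.-1; first exact: bottom_ge0.
  have := sat (false, true, i.+1, 1%N); rewrite satisfies_row; last lia.
  rewrite (big_pred1 j) /=; first by apply; have := ltn_ord i; lia.
  by move=> l; rewrite /side /= -val_eqE /=; lia.
have right_ge0 i (j : 'I_q) : j = q.-1 :> nat -> 0 <= x i j.
  move=> jq; have [i0|i_gt0] := posnP i; first exact: top_ge0.
  have [ip|i_lt] := eqVneq (i : nat) p.-1; first exact: bottom_ge0.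
  have := sat (false, false, i.+1, 1%N); rewrite satisfies_row; last lia.
  rewrite (big_pred1 j) /=; first by apply; have := ltn_ord i; lia.
  by move=> l; rewrite /side /= -val_eqE /=; have := ltn_ord l; lia.
have cols_ge0 j b m : 0 <= \sum_(l < p | side b m l) x l j.
  have [j0|j_gt0] := posnP j; first by apply: sumr_ge0 => l _; apply: left_ge0.
  have [jq|j_lt] := eqVneq (j : nat) q.-1.
    by apply: sumr_ge0 => l _; apply: right_ge0.
  have [m_out|m_in] := boolP ((m == 0)%N || (p <= m)%N).
    by rewrite sum_side_all // col_sum; case: ifP.
  rewrite -satisfies_col; apply: sat; have := ltn_ord j; rewrite /facet; lia.
split=> // i b m.
have entry_le h : x i h <= p%:R.
  (* The entry equals [p] minus the nonnegative sums of the cells above and below it. *)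
  have := sum_side_compl (fun l => x l h) true i.+1.
  rewrite sum_side_succ col_sum -[~~ true]/false.
  by have := cols_ge0 h true i; have := cols_ge0 h false i.+1; lra.
have [i0|i_gt0] := posnP i; first by apply: sumr_ge0 => h _; apply: top_ge0.
have [ip|i_lt] := eqVneq (i : nat) p.-1.
  by apply: sumr_ge0 => h _; apply: bottom_ge0.
have [m_out|] := boolP ((m == 0)%N || (q <= m)%N).
  by rewrite sum_side_all // row_sum; case: ifP.
rewrite negb_or -ltnNge -lt0n => /andP[m_gt0 lt_mq].
(* Row inequalities are indexed by the number of cells [a], whereas [m] is the cut position. *)
pose a := if b then m else (q - m)%N.
have aK : (if b then a else q - a)%N = m by rewrite /a; case: (b); lia.
have a_gt0 : (0 < a)%N by rewrite /a; case: (b); lia.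
have [a_lt|a_ge] := ltnP a (q - k).
  have := sat (false, b, i.+1, a); rewrite satisfies_row ?aK; last lia.
  by apply; have := ltn_ord i; rewrite /facet; lia.
(* Here [a >= q - k], so the complement has at most [k] cells and sum at most [k p <= q]. *)
rewrite sum_side_compl row_sum subr_ge0.
apply: le_trans (sum_side_le (~~ b) (ltnW lt_mq) entry_le) _.
rewrite -natrM ler_nat (leq_trans _ k_lb) // leq_mul2r; apply/orP; right.
by move: a_ge; rewrite /a; case: (b) => /=; lia.
Qed.

Lemma facets_ASM (x : 'M[R]_(p, q)) : line_sum_space x ->
  ASM x <-> forall t, facet t -> satisfies (line_ineq t) x.
Proof.
move=> Lx; have [col_sum row_sum] := Lx.
split=> [[_ cols rows]|/(facets_sides Lx)[cols rows]].
  have {}cols j := (prefix_bounds_sides (col_sum j) (ler0n _ _)).1 (cols^~ j).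
  have {}rows i := (prefix_bounds_sides (row_sum i) (ler0n _ _)).1 (rows i).
  move=> [[[[] b] [|i]] m]; rewrite /facet ?andbF //.
    move=> facet_t; have lt_iq : (i < q)%N by lia.
    by rewrite (satisfies_col b m (Ordinal lt_iq)).
  move=> facet_t; have lt_ip : (i < p)%N by lia.
  by rewrite (satisfies_row b (Ordinal lt_ip)) //; lia.
split=> // i j.
  exact: (prefix_bounds_sides (col_sum j) (ler0n _ _)).2 (cols j) i.
exact: (prefix_bounds_sides (row_sum i) (ler0n _ _)).2 (rows i) j.
Qed.

(** * Irredundancy *)

(** Stating satisfaction as an equality of booleans records both the violated inequality and all the
    satisfied ones; it also separates the inequalities from one another. *)
Lemma col_facet_witness b i m : facet (true, b, i, m) ->
  exists2 x, line_sum_space x & forall t, facet t ->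
    satisfies (line_ineq t) x = (t != (true, b, i, m)).
Proof.
case: i => [|j0]; first by rewrite /facet andbF.
rewrite /facet => ft; have lt_jq : (j0 < q)%N by lia.
set j := Ordinal lt_jq.
have [|v [v_sum v_side v_bd v_neg]] := @dent_vector_exists R p m b; first lia.
have v_bound l : (l < p)%N -> -1 <= v l <= q%:R.
  move=> /v_bd/andP[-> /= /le_trans]; apply.
  (* The complementary segment is nonempty, so the bound is at most [p + 1 <= q]. *)
  rewrite ler_pdivrMr ?ltr0n -?natrM ?ler_nat; last by case: (b); lia.
  by case: (b); nia.
have q_gt1 : (1 < q)%N by lia.
exists (cross_mx p j v).
  by split=> [h|l]; [apply: cross_mx_col_sum|apply: cross_mx_row_sum].
move=> [[[[] b'] [|i']] m']; rewrite /facet ?andbF // => ft'.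
  have lt_iq : (i' < q)%N by lia.
  rewrite (satisfies_col b' m' (Ordinal lt_iq)).
  have [eq_i|neq_i] := eqVneq (Ordinal lt_iq) j.
    rewrite eq_i (eq_bigr (fun l : 'I_p => v l)); last first.
      by move=> l _; rewrite mxE eqxx.
    rewrite v_side; last lia.
    by move/(congr1 val): eq_i => /= ->; rewrite !xpair_eqE !eqxx /= andbT.
  rewrite sumr_ge0 => [|l _]; last exact: cross_mx_ge0.
  by move: neq_i; rewrite -val_eqE /= !xpair_eqE; lia.
have lt_ip : (i' < p)%N by lia.
rewrite (satisfies_row b' (Ordinal lt_ip)); last lia.
rewrite !xpair_eqE /=; apply: cross_mx_row_ge0 => // Sj.
(* A row segment through an inner column [j] also contains the first or last cell of its row. For an
   outer column, a negative entry of [v] can only sit in a corner, and no row inequality concerns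
   the first or last row. *)
have [j_in|j_out] := boolP (0 < j < q.-1)%N.
  right; have q_gt0 : (0 < q)%N by lia.
  have q1_lt : (q.-1 < q)%N by lia.
  exists (if b' then Ordinal q_gt0 else Ordinal q1_lt).
    by rewrite /side; case: (b'); simpl; lia.
  by rewrite -val_eqE; case: (b'); simpl in *; lia.
left; rewrite leNgt; apply/negP => /v_neg /= eq_i.
have {}eq_i := eq_i lt_ip.
by move: ft ft' j_out eq_i; simpl; case: (b); lia.
Qed.

Lemma row_facet_witness b i m : facet (false, b, i, m) ->
  exists2 x, line_sum_space x & forall t, facet t ->
    satisfies (line_ineq t) x = (t != (false, b, i, m)).
Proof.
case: i => [|i0]; first by rewrite /facet.
rewrite /facet => ft; have lt_ip : (i0 < p)%N by lia.
set i := Ordinal lt_ip; have k_lt := cut_lt.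
pose a := (if b then m else q - m)%N.
have [|v [v_sum v_side v_bd v_neg]] := @dent_vector_exists R q a b.
  by rewrite /a; case: (b); lia.
have v_bound l : (l < q)%N -> -1 <= v l <= p%:R.
  move=> /v_bd/andP[-> /= /le_trans]; apply.
  (* The complement of a listed row segment has at least [k + 1] cells, and [q + 1 <= (k + 1) p]. *)
  rewrite ler_pdivrMr ?ltr0n -?natrM ?ler_nat /a; last by case: (b); lia.
  by case: (b); nia.
have p_gt1 : (1 < p)%N by lia.
exists (cross_mx q i v)^T.
  split=> [h|l]; under eq_bigr do rewrite mxE.
    exact: cross_mx_row_sum.
  exact: cross_mx_col_sum.
move=> [[[[] b'] [|i']] m']; rewrite /facet ?andbF // => ft'; last first.
  have lt_i'p : (i' < p)%N by lia.
  rewrite (satisfies_row b' (Ordinal lt_i'p)); last lia.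
  under eq_bigr do rewrite mxE.
  have [eq_i|neq_i] := eqVneq (Ordinal lt_i'p) i.
    rewrite eq_i (eq_bigr (fun l : 'I_q => v l)); last first.
      by move=> l _; rewrite mxE eqxx.
    rewrite v_side; last by case: (b'); lia.
    move/(congr1 val): eq_i => /= ->; rewrite !xpair_eqE !eqxx /= andbT /a.
    by case: (b); case: (b') => //=; lia.
  rewrite sumr_ge0 => [|l _]; last exact: cross_mx_ge0.
  by move: neq_i; rewrite -val_eqE /= !xpair_eqE; lia.
have lt_iq : (i' < q)%N by lia.
rewrite (satisfies_col b' m' (Ordinal lt_iq)).
under eq_bigr do rewrite mxE.
(* Row [i] is an inner row, so a column segment meeting it also contains the first or last cell of
   its column. *)
rewrite !xpair_eqE /=; apply: cross_mx_row_ge0 => // Si; right.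
have p_gt0 : (0 < p)%N by lia.
have p1_lt : (p.-1 < p)%N by lia.
exists (if b' then Ordinal p_gt0 else Ordinal p1_lt).
  by rewrite /side; case: (b'); simpl; lia.
by rewrite -val_eqE; case: (b'); simpl; lia.
Qed.

Lemma facet_witness t : facet t ->
  exists2 x, line_sum_space x & forall t', facet t' ->
    satisfies (line_ineq t') x = (t' != t).
Proof.
case: t => -[[[] b] i] m; [exact: col_facet_witness|exact: row_facet_witness].
Qed.

(** The witness for [t] violates only the inequality indexed by [t], so equal inequalities have
    equal indices. *)
Lemma line_ineq_inj : {in facets &, injective line_ineq}.
Proof.
move=> t t'; rewrite !mem_facets // => ft ft' eq_tt'.
have [x _ sat] := facet_witness ft.
by apply/esym/eqP; rewrite -[_ == _]negbK -sat // -eq_tt' sat // eqxx.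
Qed.

(** * Minimality and the number of inequalities *)

Lemma facets_minimal :
  minimal_H_representation (@line_sum_space R p q) (@ASM R p q)
    (map line_ineq facets).
Proof.
split=> [|x []//|x Lx|_ /mapP[t ft ->]].
- by rewrite (map_inj_in_uniq line_ineq_inj) facets_uniq.
- apply: iff_trans (facets_ASM Lx) _; split=> [sat _ /mapP[t + ->]|sat t ft].
    by rewrite mem_facets //; apply: sat.
  by apply: sat; apply: map_f; rewrite mem_facets.
rewrite mem_facets // in ft; have [x Lx sat] := facet_witness ft.
exists x; split=> //; last by rewrite sat // eqxx.
move=> _ /mapP[t' ft' ->] neq; rewrite mem_facets // in ft'; rewrite sat //.
by apply: contraNneq neq => ->.
Qed.

End Facets.

Theorem theorem3 (R : realType) (p q k r : nat)
    (hp : (3 <= p)%N) (hpq : (p < q)%N)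
    (hq : q = (k * p + r)%N) (hr : (r < p)%N) :
  size (ASM_ineqs R p q k) =
    (2 * ((p - 1) * (q - 2) + 2) + 2 * (p - 2) * (q - k - 1))%N /\
  minimal_H_representation (@line_sum_space R p q) (@ASM R p q)
    (ASM_ineqs R p q k).
Proof.
split.
  by rewrite /ASM_ineqs !size_cat !size_allpairs !size_iota /=; lia.
rewrite ASM_ineqs_facets; last lia.
(* Division with remainder gives [k p <= q < (k + 1) p]. *)
by apply: facets_minimal => //; lia.
Qed.
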